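(* Let $p$ be an odd prime and $n$ a positive integer, and let $G=ES_1(p,n)$ be the Heisenberg group. Then: (A) If $\sigma\in End(G)$, then the induced endomorphism $\overline{\sigma}$ of $G/\mathcal{Z}(G)$ satisfies $\langle\langle \overline{\sigma}(\overline{x}),\overline{\sigma}(\overline{y})\rangle\rangle = l\,\langle\langle \overline{x},\overline{y}\rangle\rangle$ for all $x,y\in G$, where $l\in\mathbb{F}_p$ is given by $\sigma(z)=z^{l}$ for any generator $z$ of $\mathcal{Z}(G)$. (B) Let $x_i=(e_i^n,\underline{0}^n,0)$, $y_i=(\underline{0}^n,e_i^n,0)\in G$, $1\le i\le n$. For every $\sigma\in End(G)$, writing the matrix of $\overline{\sigma}$ with respect to the ordered basis $\{\overline{x}_1,\ldots,\overline{x}_n,\overline{y}_1,\ldots,\overline{y}_n\}$ of $G/\mathcal{Z}(G)=\mathbb{F}_p^{2n}$ in $n\times n$ blocks, one has $$(1)\qquad \overline{\sigma}=\begin{pmatrix}A&C\\ D&B\end{pmatrix}\in symp^{scalar}(2n,\mathbb{F}_p),\qquad \overline{\sigma}^t\Delta\overline{\sigma}=l\Delta,\ l\in\mathbb{F}_p,$$ and for all $\underline{u},\underline{w}\in\mathbb{F}_p^n$, $z\in\mathbb{F}_p$, $$(2)\qquad \sigma(\underline{u},\underline{w},z)=(A\underline{u}+C\underline{w},\,D\underline{u}+B\underline{w},\,\widetilde{\sigma}(\underline{u},\underline{w},z)),$$ $$(3)\qquad \widetilde{\sigma}(\underline{u},\underline{w},z)=\alpha(\underline{u})+\beta(\underline{w})+lz+\tfrac12\underline{u}^t(A^tD)\underline{u}+\tfrac12\underline{w}^t(C^tB)\underline{w}+\underline{w}^t(C^tD)\underline{u}$$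 for some $\alpha,\beta\in(\mathbb{F}_p^n)^{\vee}$ and the $l\in\mathbb{F}_p$ satisfying $\overline{\sigma}^t\Delta\overline{\sigma}=l\Delta$. Conversely, if $\sigma$ is given as in (1), (2), (3), then $\sigma\in End(G)$. (C) If $\sigma\in Aut(G)$, then the induced automorphism $\overline{\sigma}$ of $G/\mathcal{Z}(G)$ satisfies $\langle\langle \overline{\sigma}(\overline{x}),\overline{\sigma}(\overline{y})\rangle\rangle = l\,\langle\langle \overline{x},\overline{y}\rangle\rangle$ for all $x,y\in G$, where $l\in\mathbb{F}_p^{*}$ is given by $\sigma(z)=z^{l}$ for any generator $z$ of $\mathcal{Z}(G)$. (D) Every $\sigma\in Aut(G)$ has the expression (1), (2), (3), with in addition $\overline{\sigma}\in Sp^{scalar}(2n,\mathbb{F}_p)$ invertible and $l\in\mathbb{F}_p^{*}$. Conversely, if $\sigma$ is given as in (1), (2), (3) with $l\neq 0$, then $\sigma\in Aut(G)$. (E) For $g\in G$ the set of endomorphism semigroup images $\{\sigma(g)\mid\sigma\in End(G)\}$ is: (a) $\{e\}$ if $g=e$, of cardinality $1$; (b) $\mathcal{Z}(G)$ if $g\in\mathcal{Z}(G)\setminus\{e\}$, of cardinality $p$; (c) $G$ if $g\in G\setminus\mathcal{Z}(G)$, of cardinality $p^{2n+1}$. (F) There are exactly three automorphism orbits in $G$: (a) $\{e\}$, of cardinality $1$; (b) $\mathcal{Z}(G)\setminus\{e\}$, of cardinality $p-1$; (c) $G\setminus\mathcal{Z}(G)$, of cardinality $p^{2n+1}-p$.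 (G) The endomorphism semigroup induces a partial order (in fact a total order) on the automorphism orbits, given by $\{e\}<\mathcal{Z}(G)\setminus\{e\}<G\setminus\mathcal{Z}(G)$.
   Context: $\mathbb{F}_p$ is the field of order $p$; $^t$ denotes transpose; $V^{\vee}$ is the dual space; $e_i^n\in\mathbb{F}_p^n$ is the $i$-th standard basis (column) vector and $\underline{0}^n$ the zero vector; $e$ is the identity of $G$. For $\underline{u},\underline{w}\in\mathbb{F}_p^n$, $\langle\underline{u},\underline{w}\rangle=\sum_{i=1}^n u_iw_i$. $ES_1(p,n)$ is the set $\mathbb{F}_p^n\oplus\mathbb{F}_p^n\oplus\mathbb{F}_p$ with group operation $(\underline{u}^1,\underline{w}^1,z^1).(\underline{u}^2,\underline{w}^2,z^2)=(\underline{u}^1+\underline{u}^2,\underline{w}^1+\underline{w}^2,z^1+z^2+\langle\underline{u}^1,\underline{w}^2\rangle)$. Its center is $\mathcal{Z}(G)=\{\underline{0}^n\}\oplus\{\underline{0}^n\}\oplus\mathbb{F}_p$, which equals the commutator subgroup and has order $p$; $G/\mathcal{Z}(G)$ is identified with $\mathbb{F}_p^{2n}$. Symplectic form: fix a generator $z$ of $\mathcal{Z}(G)$ and define $f:G\times G\to\mathbb{F}_p$ by $[x,y]=z^{f(x,y)}$; then $\langle\langle\overline{x},\overline{y}\rangle\rangle=f(x,y)$, where $\overline{x}=x\mathcal{Z}(G)$, is a non-degenerate symplectic form on $G/\mathcal{Z}(G)$. $End(G)$ is the semigroup of group endomorphisms of $G$, $Aut(G)$ its automorphism group. Each $\sigma\in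 End(G)$ (resp. $Aut(G)$) induces an endomorphism (resp. automorphism) $\overline{\sigma}$ of $G/\mathcal{Z}(G)$. Let $\Delta=\begin{pmatrix}0_{n\times n}&I_{n\times n}\\-I_{n\times n}&0_{n\times n}\end{pmatrix}$. $symp^{scalar}(2n,\mathbb{F}_p)=\{N\in M_{2n}(\mathbb{F}_p)\mid N^t\Delta N=l\Delta\text{ for some }l\in\mathbb{F}_p\}$ and $Sp^{scalar}(2n,\mathbb{F}_p)=\{M\in GL_{2n}(\mathbb{F}_p)\mid M^t\Delta M=l\Delta\text{ for some }l\in\mathbb{F}_p^{*}\}$. Partial order: for $x,y\in G$, $y$ is endomorphic to $x$ if $\sigma(x)=y$ for some $\sigma\in End(G)$, and automorphic to $x$ if $\sigma(x)=y$ for some $\sigma\in Aut(G)$. The endomorphism semigroup induces a partial order $\le$ on the set of automorphism orbits if whenever $y$ is endomorphic to $x$ and $x$ is endomorphic to $y$, then $y$ is automorphic to $x$; in this case $O_2\le O_1$ means that some $y\in O_2$ is endomorphic to some $x\in O_1$. *)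

(* Defs.v *)
From HB Require Import structures.
From mathcomp Require Import all_boot all_order all_algebra all_fingroup.
From mathcomp Require Import all_solvable.

Set Implicit Arguments.
Unset Strict Implicit.
Unset Printing Implicit Defensive.

Import GRing.Theory.
Local Open Scope ring_scope.

(* <u, w> = \sum_i u_i w_i on F_p^n, with vectors as columns. *)
Definition dotp p n (u w : 'cV['F_p]_n) : 'F_p := \sum_i u i 0 * w i 0.

(* The carrier F_p^n (+) F_p^n (+) F_p.  It is a record rather than a product
   type because a product of finite groups already carries the direct-product
   group structure. *)
Record ES1 (p n : nat) : Type := Heis {
  heis_u : 'cV['F_p]_n;
  heis_w : 'cV['F_p]_n;
  heis_z : 'F_p }.

Section HeisenbergGroup.
Variables p n : nat.
Implicit Types x y : ES1 p n.

Definition heis_pair x := (heis_u x, heis_w x, heis_z x).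
Definition pair_heis (t : 'cV['F_p]_n * 'cV['F_p]_n * 'F_p) : ES1 p n :=
  Heis t.1.1 t.1.2 t.2.
Lemma heis_pairK : cancel heis_pair pair_heis. Proof. by case. Qed.

HB.instance Definition _ := Finite.copy (ES1 p n) (can_type heis_pairK).

Definition heis_mul x y : ES1 p n :=
  Heis (heis_u x + heis_u y) (heis_w x + heis_w y)
       (heis_z x + heis_z y + dotp (heis_u x) (heis_w y)).
Definition heis_one : ES1 p n := Heis 0 0 0.
Definition heis_inv x : ES1 p n :=
  Heis (- heis_u x) (- heis_w x) (- heis_z x + dotp (heis_u x) (heis_w x)).

Lemma dotpDl (u1 u2 w : 'cV['F_p]_n) :
  dotp (u1 + u2) w = dotp u1 w + dotp u2 w.
Proof. by rewrite -big_split; apply: eq_bigr => i _; rewrite mxE mulrDl. Qed.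

Lemma dotpDr (u w1 w2 : 'cV['F_p]_n) :
  dotp u (w1 + w2) = dotp u w1 + dotp u w2.
Proof. by rewrite -big_split; apply: eq_bigr => i _; rewrite mxE mulrDr. Qed.

Lemma dotpNl (u w : 'cV['F_p]_n) : dotp (- u) w = - dotp u w.
Proof. by rewrite -sumrN; apply: eq_bigr => i _; rewrite mxE mulNr. Qed.

Lemma dotpNr (u w : 'cV['F_p]_n) : dotp u (- w) = - dotp u w.
Proof. by rewrite -sumrN; apply: eq_bigr => i _; rewrite mxE mulrN. Qed.

Lemma dotp0l (w : 'cV['F_p]_n) : dotp 0 w = 0.
Proof. by rewrite /dotp big1 // => i _; rewrite mxE mul0r. Qed.

Lemma dotp0r (u : 'cV['F_p]_n) : dotp u 0 = 0.
Proof. by rewrite /dotp big1 // => i _; rewrite mxE mulr0. Qed.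

Lemma dotp_delta (u : 'cV['F_p]_n) i : dotp u (delta_mx i 0) = u i 0.
Proof.
rewrite /dotp (bigD1 i) //= big1 ?addr0 ?mxE ?eqxx ?mulr1 // => j ji.
by rewrite mxE (negPf ji) mulr0.
Qed.

Lemma dotp_deltal (w : 'cV['F_p]_n) i : dotp (delta_mx i 0) w = w i 0.
Proof.
by rewrite -[RHS]dotp_delta; apply: eq_bigr => j _; rewrite mulrC.
Qed.

Lemma heis_mulA : associative heis_mul.
Proof.
move=> [u1 w1 z1] [u2 w2 z2] [u3 w3 z3].
rewrite /heis_mul /= !addrA dotpDl dotpDr !addrA; congr Heis.
rewrite -!addrA; do 2!congr (_ + _).
by rewrite [dotp u2 w3 + _]addrC !addrA [z3 + _]addrC.
Qed.

Lemma heis_mul1 : left_id heis_one heis_mul.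
Proof. by case=> u w z; rewrite /heis_mul /= !add0r dotp0l addr0. Qed.

Lemma heis_mulV : left_inverse heis_one heis_inv heis_mul.
Proof.
case=> u w z; rewrite /heis_mul /= !addNr dotpNl; congr Heis.
by rewrite addrAC addrK addNr.
Qed.

HB.instance Definition _ :=
  Finite_isGroup.Build (ES1 p n) heis_mulA heis_mul1 heis_mulV.

End HeisenbergGroup.

Section Endomorphisms.
Variable gT : finGroupType.
Local Notation G := [set: gT].

Definition End : {set {ffun gT -> gT}} := [set s : {ffun gT -> gT} | morphic G s].

(* The endomorphism of G / Z(G) induced by s, evaluated on a coset through a
   representative; [induced_coset] below is its characteristic property. *)
Definition induced (s : gT -> gT) (X : coset_of 'Z(G)) : coset_of 'Z(G) :=
  coset 'Z(G) (s (repr X)).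

(* [comm_log p z x y] is the k in F_p with [x, y] = z^k.  The convention used
   for commutators is immaterial, commutators being central here. *)
Definition comm_log p (z x y : gT) : 'F_p :=
  odflt 0 [pick k : 'F_p | [~ x, y] == z ^+ (k : nat)]%g.

(* The symplectic form on G / Z(G) attached to the generator z of Z(G);
   see [sympform_coset]. *)
Definition sympform p (z : gT) (X Y : coset_of 'Z(G)) : 'F_p :=
  comm_log p z (repr X) (repr Y).

Definition endomorphic (y x : gT) : bool := [exists s in End, s x == y].
Definition automorphic (y x : gT) : bool := [exists s in Aut G, s x == y].

Definition aut_orbit (x : gT) : {set gT} := orbit 'P (Aut G) x.
Definition aut_orbits : {set {set gT}} := [set aut_orbit x | x in G].

Definition End_induces_order : Prop :=
  forall x y : gT, endomorphic y x -> endomorphic x y -> automorphic y x.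

Definition orbit_le (O2 O1 : {set gT}) : bool :=
  [exists y in O2, exists x in O1, endomorphic y x].
Definition orbit_lt (O2 O1 : {set gT}) : bool :=
  (O2 != O1) && orbit_le O2 O1.

End Endomorphisms.

(* The set of values of all endomorphisms at g. *)
Definition End_images (gT : finGroupType) (g : gT) : {set gT} :=
  [set (s : {ffun gT -> gT}) g | s in End gT].

Section Matrices.
Variables p n : nat.
Local Notation G := [set: ES1 p n].

Definition Delta : 'M['F_p]_(n + n) := block_mx 0 1%:M (- 1%:M) 0.

Definition symp_scalar : {set 'M['F_p]_(n + n)} :=
  [set N : 'M['F_p]_(n + n) | [exists l : 'F_p, N^T *m Delta *m N == l *: Delta]].

Definition Sp_scalar : {set 'M['F_p]_(n + n)} :=
  [set M : 'M['F_p]_(n + n) | (M \in unitmx) &&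
     [exists l : 'F_p, (l != 0) && (M^T *m Delta *m M == l *: Delta)]].

Definition heis_x (i : 'I_n) : ES1 p n := Heis (delta_mx i 0) 0 0.
Definition heis_y (i : 'I_n) : ES1 p n := Heis 0 (delta_mx i 0) 0.

(* The ordered basis x_1, ..., x_n, y_1, ..., y_n of G / Z(G). *)
Definition qbasis (k : 'I_(n + n)) : coset_of 'Z(G) :=
  match split k with
  | inl i => coset 'Z(G) (heis_x i)
  | inr j => coset 'Z(G) (heis_y j)
  end.

(* The identification of G / Z(G) with F_p^(2n), (u, w, z)Z(G) |-> (u, w);
   by [qvec_coset], [qvecM] and [qvec_basis] it is a well-defined isomorphism
   taking [qbasis] to the standard basis. *)
Definition qvec (X : coset_of 'Z(G)) : 'cV['F_p]_(n + n) :=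
  col_mx (heis_u (repr X)) (heis_w (repr X)).

(* Matrix of T in the basis [qbasis]: column j holds the coordinates of the
   image of the j-th basis vector. *)
Definition qmatrix (T : coset_of 'Z(G) -> coset_of 'Z(G)) : 'M['F_p]_(n + n) :=
  \matrix_(i, j) qvec (T (qbasis j)) i 0.

(* v^t N u as a scalar. *)
Definition bilin (v : 'cV['F_p]_n) (N : 'M['F_p]_n) (u : 'cV['F_p]_n) : 'F_p :=
  (v^T *m N *m u) 0 0.

Definition sigma_tilde (A B C D : 'M['F_p]_n) (l : 'F_p)
    (alpha beta : {scalar 'cV['F_p]_n}) (u w : 'cV['F_p]_n) (z : 'F_p) : 'F_p :=
  alpha u + beta w + l * z + 2%:R^-1 * bilin u (A^T *m D) u
    + 2%:R^-1 * bilin w (C^T *m B) w + bilin w (C^T *m D) u.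

Definition has_expression (s : ES1 p n -> ES1 p n) (A B C D : 'M['F_p]_n)
    (l : 'F_p) (alpha beta : {scalar 'cV['F_p]_n}) : Prop :=
  forall (u w : 'cV['F_p]_n) (z : 'F_p),
    s (Heis u w z) = Heis (A *m u + C *m w) (D *m u + B *m w)
                          (sigma_tilde A B C D l alpha beta u w z).

End Matrices.

Arguments heis_x {p n} i.
Arguments heis_y {p n} i.
Arguments qbasis {p n} k.

Section WellDefined.
Variables p n : nat.
Local Notation G := [set: ES1 p n].
Local Notation Z := 'Z(G)%g.
Implicit Types (x y z : ES1 p n) (s : {ffun ES1 p n -> ES1 p n}).

Lemma heisM x y : (x * y)%g = heis_mul x y. Proof. by []. Qed.
Lemma heisV x : (x^-1)%g = heis_inv x. Proof. by []. Qed.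

Lemma heis_comm x y :
  [~ x, y]%g = Heis 0 0 (dotp (heis_u x) (heis_w y) - dotp (heis_u y) (heis_w x)).
Proof.
case: x y => [u1 w1 z1] [u2 w2 z2].
apply: (mulgI (Heis u2 w2 z2 * Heis u1 w1 z1)%g).
rewrite commgEl /conjg !mulgA mulgK mulgV mul1g !heisM /heis_mul /= !addr0.
rewrite dotp0r addr0 [u2 + _]addrC [w2 + _]addrC; congr Heis.
by rewrite [z2 + _]addrC -[RHS]addrA [dotp u2 w1 + _]addrC subrK.
Qed.

Lemma heis_centerP x : reflect (heis_u x = 0 /\ heis_w x = 0) (x \in Z).
Proof.
apply: (iffP idP) => [/centerP[_ cx]|[u0 w0]].
  have comm0 y : dotp (heis_u x) (heis_w y) - dotp (heis_u y) (heis_w x) = 0.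
    have /commgP/eqP := cx y (in_setT y).
    by rewrite heis_comm => /(congr1 (@heis_z p n)).
  split; apply/colP=> i; rewrite mxE.
    by have := comm0 (heis_y i); rewrite /= dotp_delta dotp0l subr0.
  have := comm0 (heis_x i); rewrite /= dotp_deltal dotp0r sub0r.
  by move/eqP; rewrite oppr_eq0 => /eqP.
apply/centerP; split=> [|y _]; first by rewrite in_setT.
by apply/commgP/eqP; rewrite heis_comm u0 w0 dotp0l dotp0r subr0.
Qed.

Lemma heis_comm_center x y : [~ x, y]%g \in Z.
Proof. by rewrite heis_comm; apply/heis_centerP. Qed.

Lemma heis_norm x : (x \in 'N(Z))%g.
Proof. by apply: (subsetP (normal_norm (center_normal G))); rewrite in_setT. Qed.

Lemma heis_coset_eq x y :
  coset Z x = coset Z y <-> heis_u x = heis_u y /\ heis_w x = heis_w y.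
Proof.
have E : reflect (coset Z x = coset Z y) ((x * y^-1)%g \in Z).
  by rewrite -mem_rcoset; apply: rcoset_kercosetP; exact: heis_norm.
split=> [/E/heis_centerP[/= /eqP + /eqP]|[eu ew]].
  by rewrite !subr_eq0 => /eqP-> /eqP->.
by apply/E/heis_centerP; rewrite /= eu ew !subrr.
Qed.

Lemma repr_heis x : let x' := repr (coset Z x) in
  heis_u x' = heis_u x /\ heis_w x' = heis_w x.
Proof. by apply/heis_coset_eq; exact: coset_reprK. Qed.

Lemma EndP s : reflect {morph s : x y / (x * y)%g} (s \in End (ES1 p n)).
Proof.
rewrite inE; apply: (iffP morphicP) => [sM x y|sM x y _ _]; last exact: sM.
by apply: sM; rewrite in_setT.
Qed.

Lemma End_comm s x y :
  s \in End (ES1 p n) -> s [~ x, y]%g = [~ s x, s y]%g.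
Proof.
move=> /EndP sM.
have s1 : s 1%g = 1%g by apply: (mulgI (s 1%g)); rewrite -sM !mulg1.
have sV a : s (a^-1)%g = ((s a)^-1)%g.
  by apply: (mulgI (s a)); rewrite -sM !mulgV.
by rewrite /commg /conjg !sM !sV.
Qed.

Lemma End_center s z : s \in End (ES1 p n) -> z \in Z -> s z \in Z.
Proof.
move=> sE /heis_centerP; case: z => u w c /= [-> ->].
case: (pickP 'I_n) => [i _|noI].
  have -> : Heis 0 0 c = [~ heis_x i, Heis 0 (c *: delta_mx i 0) 0]%g.
    by rewrite heis_comm /= dotp_deltal dotp0l subr0 !mxE !eqxx mulr1.
  by rewrite End_comm //; exact: heis_comm_center.
by apply/heis_centerP; split; apply/colP=> i; have := noI i.
Qed.

Lemma induced_coset s x :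
  s \in End (ES1 p n) -> induced s (coset Z x) = coset Z (s x).
Proof.
move=> sE; have /EndP sM := sE; rewrite /induced.
set x' := repr _; have [eu ew] : heis_u x' = heis_u x /\ heis_w x' = heis_w x.
  exact: repr_heis.
have cZ : (x' * x^-1)%g \in Z by apply/heis_centerP; rewrite /= eu ew !subrr.
have /heis_centerP[su sw] := End_center sE cZ.
apply/heis_coset_eq; rewrite -[x'](mulgKV x) sM /=.
by rewrite su sw !add0r.
Qed.

Lemma induced_Aut (a : {perm ES1 p n}) x :
  a \in Aut G -> induced a (coset Z x) = coset Z (a x).
Proof.
move=> aA; have aE : [ffun x => a x] \in End (ES1 p n).
  by apply/EndP => u v; rewrite !ffunE (morphicP (Aut_morphic aA)) ?in_setT.
by have := induced_coset x aE; rewrite /induced !ffunE.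
Qed.

Lemma induced_morph s : s \in End (ES1 p n) ->
  {morph @induced (ES1 p n) s : X Y / (X * Y)%g}.
Proof.
move=> sE X Y; rewrite -(coset_reprK X) -(coset_reprK Y).
have M := morphM (coset_morphism Z).
rewrite -M ?heis_norm // !induced_coset //; have /EndP-> := sE.
by rewrite M ?heis_norm.
Qed.

Lemma induced_bij (a : {perm ES1 p n}) : a \in Aut G ->
  bijective (@induced (ES1 p n) a).
Proof.
move=> aA; have bA : (a^-1)%g \in Aut G by rewrite groupV.
exists (@induced (ES1 p n) (a^-1)%g) => X; rewrite -(coset_reprK X);
  move: (repr X) => x.
  by rewrite (induced_Aut x aA) (induced_Aut _ bA) permK.
by rewrite (induced_Aut x bA) (induced_Aut _ aA) permKV.
Qed.

Lemma sympform_coset z x y : generator Z z ->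
  [~ x, y]%g = (z ^+ (sympform p z (coset Z x) (coset Z y) : nat))%g.
Proof.
move=> /eqP Zz.
have -> : [~ x, y]%g = [~ repr (coset Z x), repr (coset Z y)]%g.
  have [xu xw] := repr_heis x; have [yu yw] := repr_heis y.
  by rewrite !heis_comm xu xw yu yw.
rewrite /sympform /comm_log; set c := [~ _, _]%g.
case: pickP => [k /eqP //|noK].
have : c \in Z by exact: heis_comm_center.
rewrite Zz => /cycleP[m cE].
have /heis_centerP[zu zw] : z \in Z by rewrite Zz cycle_id.
have zX i : (z ^+ i)%g = Heis 0 0 (heis_z z *+ i).
  elim: i => [|i IH]; first by rewrite expg0 mulr0n.
  by rewrite expgS IH heisM /heis_mul /= zu zw dotp0l !addr0 mulrS.
have := noK m%:R; rewrite cE !zX -[heis_z z *+ (m%:R : 'F_p)]mulr_natr.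
by rewrite natr_Zp mulr_natr eqxx.
Qed.

Lemma qvec_coset u w c : qvec (coset Z (Heis u w c)) = col_mx u w.
Proof. by rewrite /qvec; have [-> ->] := repr_heis (Heis u w c). Qed.

Lemma qvecM : {morph @qvec p n : X Y / (X * Y)%g >-> X + Y}.
Proof.
move=> X Y; rewrite -(coset_reprK X) -(coset_reprK Y).
case: (repr X) (repr Y) => [u1 w1 c1] [u2 w2 c2].
rewrite -(morphM (coset_morphism Z)) ?heis_norm // heisM.
by rewrite !qvec_coset add_col_mx.
Qed.

Lemma qvec_inj : injective (@qvec p n).
Proof.
move=> X Y; rewrite -(coset_reprK X) -(coset_reprK Y).
case: (repr X) (repr Y) => [u1 w1 c1] [u2 w2 c2].
rewrite !qvec_coset => /eq_col_mx[-> ->]; exact/heis_coset_eq.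
Qed.

Lemma qvec_basis k : qvec (qbasis k) = delta_mx k 0 :> 'cV['F_p]_(n + n).
Proof.
rewrite -[k in RHS](splitK k) /qbasis; case: (split k) => i /=.
  rewrite qvec_coset; apply/colP=> j; rewrite -(splitK j).
  case: (split j) => {}j; rewrite /= ?col_mxEu ?col_mxEd !mxE ?eq_lshift //.
  by rewrite eq_rlshift.
rewrite qvec_coset; apply/colP=> j; rewrite -(splitK j).
case: (split j) => {}j; rewrite /= ?col_mxEu ?col_mxEd !mxE ?eq_rshift //.
by rewrite eq_lrshift.
Qed.

Lemma qvec1 : qvec (1%g : coset_of Z) = 0.
Proof. by apply: (addrI (qvec (1%g : coset_of Z))); rewrite -qvecM mulg1 addr0. Qed.

Lemma qvecX (X : coset_of Z) m : qvec (X ^+ m)%g = qvec X *+ m.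
Proof.
elim: m => [|m IH]; first by rewrite expg0 qvec1.
by rewrite expgS qvecM IH mulrS.
Qed.

(* The entries of [qvec X] are the coordinates of X in the basis [qbasis]. *)
Lemma qvec_coord (X : coset_of Z) :
  X = (\prod_k qbasis k ^+ (qvec X k 0 : nat))%g.
Proof.
apply: qvec_inj; rewrite (big_morph (@qvec p n) qvecM qvec1).
apply/colP=> j; rewrite summxE (bigD1 j) //= big1 => [|k kj].
  by rewrite addr0 qvecX qvec_basis mulmxnE [delta_mx _ _ _ _]mxE !eqxx natr_Zp.
by rewrite qvecX qvec_basis mulmxnE [delta_mx _ _ _ _]mxE eq_sym (negPf kj) mul0rn.
Qed.

End WellDefined.

(* Main.v *)
Require Import Defs.
From HB Require Import structures.
From mathcomp Require Import all_boot all_order all_algebra all_fingroup.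
From mathcomp Require Import all_solvable ring.

Set Implicit Arguments.
Unset Strict Implicit.
Unset Printing Implicit Defensive.

Import GRing.Theory.
Local Open Scope ring_scope.

(** An endomorphism s scales the center by some l, and s [x, y] = [s x, s y]
    says that its action on G / Z(G) scales the symplectic form by l.  This is
    exactly what makes the z-coordinate of s, minus the quadratic correction in
    (3), additive on each of the two Lagrangian summands, hence linear; the
    z-coordinate elsewhere follows from
    (u, w, z) = (0, w, 0) (u, 0, 0) (0, 0, z).
    For the orbits: (3) lifts symplectic transvections to automorphisms, two of
    them move any nonzero vector of G / Z(G) to any other, and inner
    automorphisms adjust the central coordinate; on the center one uses the
    dilations (u, w, z) |-> (u, l w, l z).  Since G has exponent p, a
    noncentral g maps to any h under x |-> h^(phi x) with phi a character
    G -> F_p such that phi g = 1. *)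

(** Every scalar of a prime field is a natural multiple of 1, so additivity already gives
    linearity. *)
Lemma Fp_additive_scalable p (V W : lmodType 'F_p) (f : V -> W) :
  {morph f : x y / x + y} -> scalable f.
Proof.
move=> fD a v; have f0 : f 0 = 0 by apply: (addrI (f 0)); rewrite -fD !addr0.
have fMn m : f (v *+ m) = f v *+ m.
  by elim: m => [|m IH]; rewrite ?mulr0n // !mulrS fD IH.
by rewrite -[a]natr_Zp !scaler_nat fMn.
Qed.

Lemma Fp_additive_scalar p (V : lmodType 'F_p) (f : V -> 'F_p) :
  {morph f : x y / x + y} -> exists g : {scalar V}, f =1 g.
Proof.
move=> fD; have fL : scalar f.
  by move=> a x y; rewrite fD (@Fp_additive_scalable p V ('F_p)^o f fD).
by exists (HB.pack_for {scalar V} f (GRing.isLinear.Build _ _ _ _ f fL)).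
Qed.

(** * The standard symplectic form on F_p^(2n), its similitudes and transvections *)

Section SymplecticForm.
Variables p n : nat.
Implicit Types (x y : 'cV['F_p]_(n + n)) (M : 'M['F_p]_(n + n)) (l : 'F_p).
Implicit Types (u w : 'cV['F_p]_n).

Definition symp x y : 'F_p := (x^T *m Delta p n *m y) 0 0.

Lemma dotpE u w : dotp u w = (u^T *m w) 0 0.
Proof. by rewrite mxE; apply: eq_bigr => i _; rewrite mxE. Qed.

Lemma dotpC u w : dotp u w = dotp w u.
Proof. by apply: eq_bigr => i _; rewrite mulrC. Qed.

Lemma dotpZr a u w : dotp u (a *: w) = a * dotp u w.
Proof. by rewrite !dotpE -scalemxAr mxE. Qed.

Lemma bilinE (P Q : 'M['F_p]_n) u w :
  bilin w (P^T *m Q) u = dotp (P *m w) (Q *m u).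
Proof. by rewrite dotpE /bilin trmx_mul !mulmxA. Qed.

Lemma symp_col_mx u1 w1 u2 w2 :
  symp (col_mx u1 w1) (col_mx u2 w2) = dotp u1 w2 - dotp u2 w1.
Proof.
rewrite [dotp u2 _]dotpC !dotpE /symp /Delta tr_col_mx mul_row_block.
by rewrite mul_row_col !mulmx0 mulmxN !mulmx1 add0r addr0 mulNmx addrC !mxE.
Qed.

Lemma sympDr x y1 y2 : symp x (y1 + y2) = symp x y1 + symp x y2.
Proof. by rewrite /symp mulmxDr mxE. Qed.

Lemma sympBl x1 x2 y : symp (x1 - x2) y = symp x1 y - symp x2 y.
Proof. by rewrite /symp [(x1 - x2)^T]linearB /= !mulmxBl !mxE. Qed.

Lemma symp_sym x y : symp y x = - symp x y.
Proof.
rewrite -(vsubmxK x) -(vsubmxK y) !symp_col_mx opprB.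
by rewrite [dotp (usubmx y) _]dotpC.
Qed.

Lemma sympxx x : symp x x = 0.
Proof. by rewrite -(vsubmxK x) symp_col_mx dotpC subrr. Qed.

(** Pairing with a standard basis vector reads off one coordinate of [x] up to sign. *)
Lemma symp_nondeg x : x != 0 -> exists y, symp x y != 0.
Proof.
move=> x0; apply/existsP; apply: contra_neqT x0; rewrite negb_exists.
move=> /forallP s0; rewrite -(vsubmxK x).
have {}s0 y : symp x y = 0 by apply/eqP; move: (s0 y); rewrite negbK.
rewrite -[RHS](vsubmxK 0) !linear0; congr col_mx; apply/colP => i; rewrite [RHS]mxE.
  have := s0 (col_mx 0 (delta_mx i 0)).
  by rewrite -{1}(vsubmxK x) symp_col_mx dotp_delta dotp0l subr0.
have := s0 (col_mx (delta_mx i 0) 0).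
rewrite -{1}(vsubmxK x) symp_col_mx dotp_deltal dotp0r sub0r.
by move/eqP; rewrite oppr_eq0 => /eqP.
Qed.

(* Two hyperplanes never cover the space. *)
Lemma symp_avoid x y : x != 0 -> y != 0 ->
  exists2 v, symp x v != 0 & symp v y != 0.
Proof.
move=> /symp_nondeg[a xa] /symp_nondeg[b yb].
have s v : (symp v y != 0) = (symp y v != 0) by rewrite symp_sym oppr_eq0.
have [ya|ya] := eqVneq (symp y a) 0; last by exists a; rewrite ?s.
have [xb|xb] := eqVneq (symp x b) 0; last by exists b; rewrite ?s.
(* Now [a] is orthogonal to [y] and [b] to [x], so [a + b] pairs with [x] as [a] does and with [y]
   as [b] does. *)
by exists (a + b); rewrite ?s sympDr ?xb ?ya ?addr0 ?add0r.
Qed.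

Lemma Delta_sqr : Delta p n *m Delta p n = - 1%:M.
Proof.
rewrite /Delta mulmx_block !mulmx0 !mul0mx !mulmx1 !mul1mx !addr0 !add0r.
by rewrite [in RHS]scalar_mx_block opp_block_mx oppr0.
Qed.

Lemma symp_similitudeP M l :
  (M^T *m Delta p n *m M = l *: Delta p n) <->
  (forall x y, symp (M *m x) (M *m y) = l * symp x y).
Proof.
have sympM x y :
    symp (M *m x) (M *m y) = (x^T *m (M^T *m Delta p n *m M) *m y) 0 0.
  by rewrite /symp trmx_mul !mulmxA.
split=> [E x y|E]; first by rewrite sympM E -scalemxAr -scalemxAl mxE.
apply/matrixP => i j; have := E (delta_mx i 0) (delta_mx j 0).
rewrite sympM /symp !trmx_delta -!rowE -!colE ![col _ _ _ _]mxE
   ![row _ _ _ _]mxE => ->.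
by rewrite [RHS]mxE.
Qed.

(** Since [Delta] squares to -1, the matrix - l^-1 Delta M^T Delta is a left inverse of [M]. *)
Lemma similitude_unit M l :
  M^T *m Delta p n *m M = l *: Delta p n -> l != 0 -> M \in unitmx.
Proof.
move=> E l0; have/mulmx1_unit[] // :
    (- l^-1 *: Delta p n *m M^T *m Delta p n) *m M = 1%:M.
rewrite -!scalemxAl -!mulmxA [M^T *m _]mulmxA E -scalemxAr Delta_sqr scalerA.
by rewrite mulNr mulVf // scaleN1r opprK.
Qed.

Definition transvection a x : 'M['F_p]_(n + n) :=
  1%:M + a *: (x *m x^T *m Delta p n).

Lemma transvectionE a x y : transvection a x *m y = y + (a * symp x y) *: x.
Proof.
rewrite mulmxDl mul1mx -scalemxAl -!mulmxA [x^T *m _]mulmxA.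
by rewrite [x^T *m _ *m y]mx11_scalar mul_mx_scalar scalerA.
Qed.

(** The cross terms cancel by antisymmetry and the term in a^2 vanishes because [symp x x = 0]. *)
Lemma transvection_symp a x :
  (transvection a x)^T *m Delta p n *m transvection a x = 1 *: Delta p n.
Proof.
apply/symp_similitudeP => y1 y2; rewrite !transvectionE mul1r.
have sZ b v1 v2 : symp v1 (b *: v2) = b * symp v1 v2.
  by rewrite /symp -scalemxAr mxE.
rewrite sympDr sZ symp_sym [symp (_ + _) x]symp_sym !sympDr !sZ sympxx.
by rewrite [symp y2 y1]symp_sym [symp y2 x]symp_sym; ring.
Qed.

(** The direction [y - x] pairs with [x] as [y] does, and the scalar normalises that pairing to
    1. *)
Lemma transvection_move x y : symp x y != 0 ->
  exists a v, transvection a v *m x = y.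
Proof.
move=> xy; exists (symp y x)^-1, (y - x).
rewrite transvectionE sympBl sympxx subr0 mulVf ?scale1r 1?addrC ?subrK //.
by rewrite symp_sym oppr_eq0.
Qed.

End SymplecticForm.

(** * Coordinates on the Heisenberg group: the vector modulo the centre and the central scalar *)

Section HeisenbergElements.
Variables p n : nat.
Local Notation G := [set: ES1 p n].
Local Notation Z := 'Z(G)%g.
Implicit Types (x y z : ES1 p n) (s : {ffun ES1 p n -> ES1 p n}).
Implicit Types (c : 'F_p) (u w : 'cV['F_p]_n).

(** The coordinates [qvec] of the coset of [x], read off [x] itself so that no representative is
    chosen. *)
Definition hvec x : 'cV['F_p]_(n + n) := col_mx (heis_u x) (heis_w x).

Definition hcen c : ES1 p n := Heis 0 0 c.

Lemma hvecM x y : hvec (x * y)%g = hvec x + hvec y.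
Proof. by rewrite add_col_mx. Qed.

Lemma qvec_hvec x : qvec (coset Z x) = hvec x.
Proof. by case: x => u w c; rewrite qvec_coset. Qed.

Lemma hcenD c d : hcen (c + d) = (hcen c * hcen d)%g.
Proof. by rewrite heisM /heis_mul /= dotp0l !addr0. Qed.

Lemma hcenX c m : (hcen c ^+ m)%g = hcen (c *+ m).
Proof. by elim: m => // m IH; rewrite expgS IH mulrS hcenD. Qed.

Lemma hcen_inj : injective hcen.
Proof. by move=> c d []. Qed.

Lemma center_hcenP x : reflect (exists c, x = hcen c) (x \in Z).
Proof.
apply: (iffP (heis_centerP x)) => [[]|[c ->] //].
by case: x => u w c /= -> ->; exists c.
Qed.

Lemma hcen_in c : hcen c \in Z. Proof. by apply/center_hcenP; exists c. Qed.

Lemma hvec_eq0 x : (hvec x == 0) = (x \in Z).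
Proof.
rewrite col_mx_eq0; apply/andP/heis_centerP => [[/eqP-> /eqP->] //|[-> ->]].
by rewrite eqxx.
Qed.

Lemma commg_symp x y : [~ x, y]%g = hcen (symp (hvec x) (hvec y)).
Proof. by rewrite heis_comm symp_col_mx. Qed.

Lemma generator_centerP z : generator Z z -> exists2 c, c != 0 & z = hcen c.
Proof.
move=> /eqP gz; have /center_hcenP[c zE] : z \in Z by rewrite gz cycle_id.
exists c => //; apply/eqP => c0; have := hcen_in 1.
rewrite gz zE c0 => /cycleP[m]; rewrite hcenX mul0rn => /hcen_inj/eqP.
by rewrite oner_eq0.
Qed.

(** Compares central coordinates in [x, y] = z^k. Another generator only rescales the form, so the
    multiplier of an endomorphism does not depend on it. *)
Lemma sympformE c x y : generator Z (hcen c) ->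
  c * sympform p (hcen c) (coset Z x) (coset Z y) = symp (hvec x) (hvec y).
Proof.
move=> gz; apply: hcen_inj; rewrite -commg_symp (sympform_coset x y gz) hcenX.
by rewrite -mulr_natr natr_Zp.
Qed.

Lemma Aut_heisP (a : {perm ES1 p n}) :
  reflect {morph a : x y / (x * y)%g} (a \in Aut G).
Proof.
rewrite inE; apply: (iffP andP) => [[_ /morphicP aM] x y|aM].
  by apply: aM; rewrite in_setT.
by split; [apply/subsetP => x; rewrite in_setT | apply/morphicP => x y _ _].
Qed.

Lemma Aut_End (a : {perm ES1 p n}) :
  a \in Aut G -> [ffun x => a x] \in End (ES1 p n).
Proof. by move=> /Aut_heisP aM; apply/EndP => x y; rewrite !ffunE. Qed.

Lemma End_inj_Aut s : s \in End (ES1 p n) -> injective s ->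
  exists2 a : {perm ES1 p n}, a \in Aut G & s =1 a.
Proof.
move=> /EndP sM sI; exists (perm sI) => [|x]; last by rewrite permE.
by apply/Aut_heisP => x y; rewrite !permE.
Qed.

(** * The action of one endomorphism on the centre and on the quotient *)

Section EndomorphismCoordinates.
Variable s : {ffun ES1 p n -> ES1 p n}.
Hypothesis sE : s \in End (ES1 p n).

Let sM : {morph s : x y / (x * y)%g}. Proof. exact/EndP. Qed.

(** The scalar l of the theorem. The image of [hcen 1] is central, so its last coordinate determines
    it. *)
Definition central_mult : 'F_p := heis_z (s (hcen 1)).

Lemma End_hcen c : s (hcen c) = hcen (central_mult * c).
Proof.
have sX x m : s (x ^+ m)%g = (s x ^+ m)%g.
  elim: m => [|m IH]; last by rewrite !expgS sM IH.
  by apply: (mulgI (s 1%g)); rewrite -sM !mulg1.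
have /center_hcenP[d dE] := End_center sE (hcen_in 1).
rewrite /central_mult -[c]natr_Zp -hcenX sX dE hcenX /=.
by rewrite mulr_natr.
Qed.

(** A coset is a product of powers of the elements [qbasis k]; applying [induced s] factor by factor
    gives the matrix product. *)
Lemma hvec_End x : hvec (s x) = qmatrix (induced s) *m hvec x.
Proof.
have iM := induced_morph sE.
have i1 : induced s 1%g = 1%g :> coset_of Z.
  by apply: (mulgI (induced s 1%g)); rewrite -iM !mulg1.
have iX X m : induced s (X ^+ m)%g = (induced s X ^+ m)%g :> coset_of Z.
  by elim: m => [|m IH]; rewrite ?expg0 // !expgS iM IH.
rewrite -!qvec_hvec -induced_coset //; move: (coset Z x) => X.
rewrite {1}(qvec_coord X) (big_morph _ iM i1).
rewrite (big_morph _ (@qvecM p n) (@qvec1 p n)).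
apply/colP => i; rewrite summxE mxE; apply: eq_bigr => k _.
by rewrite iX qvecX mulmxnE [qmatrix _ _ _]mxE
  -[in RHS](natr_Zp (qvec X k 0)) mulr_natr.
Qed.

Lemma symp_End x y :
  symp (hvec (s x)) (hvec (s y)) = central_mult * symp (hvec x) (hvec y).
Proof.
by apply: hcen_inj; rewrite -End_hcen -!commg_symp End_comm.
Qed.

Lemma similitude_End :
  (qmatrix (induced s))^T *m Delta p n *m qmatrix (induced s)
    = central_mult *: Delta p n.
Proof.
apply/symp_similitudeP => x y.
have H v : exists g, v = hvec g.
  by exists (Heis (usubmx v) (dsubmx v) 0); rewrite /hvec vsubmxK.
by have [[g ->] [h ->]] := (H x, H y); rewrite -!hvec_End symp_End.
Qed.

Lemma End_generator z :
  generator Z z -> s z = (z ^+ (central_mult : nat))%g.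
Proof.
move=> /generator_centerP[c _ ->].
by rewrite End_hcen hcenX -mulr_natr natr_Zp mulrC.
Qed.

Lemma sympform_End z x y : generator Z z ->
  sympform p z (induced s (coset Z x)) (induced s (coset Z y))
  = central_mult * sympform p z (coset Z x) (coset Z y).
Proof.
move=> gz; have [c c0 zE] := generator_centerP gz; rewrite zE in gz *.
(* Multiplied by the nonzero [c], both sides become values of [symp]. *)
rewrite (induced_coset x sE) (induced_coset y sE); apply: (@mulfI 'F_p c c0).
rewrite (sympformE (s x) (s y) gz) [RHS]mulrCA (sympformE x y gz).
exact: symp_End.
Qed.

End EndomorphismCoordinates.

End HeisenbergElements.

(** * The explicit formula for endomorphisms, in both directions *)

Section Expression.
Variables p n : nat.
Hypotheses (p_pr : prime p) (p_odd : odd p).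
Implicit Types (A B C D : 'M['F_p]_n) (l : 'F_p).
Implicit Types (s : {ffun ES1 p n -> ES1 p n}).

Lemma two_neq0 : 2%:R != 0 :> 'F_p.
Proof.
rewrite -(dvdn_pcharf (pchar_Fp p_pr)) dvdn_prime2 //.
by apply: contraL p_odd => /eqP->.
Qed.

Section Similitude.
Variables (A B C D : 'M['F_p]_n) (l : 'F_p).
Hypothesis E :
  (block_mx A C D B)^T *m Delta p n *m block_mx A C D B = l *: Delta p n.

Let sympE u1 w1 u2 w2 :
  dotp (A *m u1 + C *m w1) (D *m u2 + B *m w2)
   - dotp (A *m u2 + C *m w2) (D *m u1 + B *m w1)
  = l * (dotp u1 w2 - dotp u2 w1).
Proof.
have /symp_similitudeP/(_ (col_mx u1 w1) (col_mx u2 w2)) := E.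
by rewrite !mul_block_col !symp_col_mx.
Qed.

(** The vectors (u, 0) span an isotropic subspace, where the similitude identity says that
    [A^T *m D] is symmetric. *)
Lemma similitude_AD u1 u2 : dotp (A *m u1) (D *m u2) = dotp (A *m u2) (D *m u1).
Proof.
have := sympE u1 0 u2 0; rewrite !mulmx0 !addr0 !dotp0r subrr mulr0.
by move/eqP; rewrite subr_eq0 => /eqP.
Qed.

Lemma similitude_CB w1 w2 : dotp (C *m w1) (B *m w2) = dotp (C *m w2) (B *m w1).
Proof.
have := sympE 0 w1 0 w2; rewrite !mulmx0 !add0r !dotp0l subrr mulr0.
by move/eqP; rewrite subr_eq0 => /eqP.
Qed.

(** The similitude identity on (u, 0) and (0, w), the mixed case in which [l] survives. *)
Lemma similitude_AB u w :
  dotp (A *m u) (B *m w) = l * dotp u w + dotp (C *m w) (D *m u).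
Proof.
have := sympE u 0 0 w; rewrite !mulmx0 !addr0 !add0r !dotp0l subr0 => <-.
by rewrite subrK.
Qed.

Lemma expression_End s (alpha beta : {scalar 'cV['F_p]_n}) :
  has_expression s A B C D l alpha beta -> s \in End (ES1 p n).
Proof.
move=> sX; apply/EndP => -[u1 w1 z1] [u2 w2 z2].
rewrite !heisM /heis_mul /= !sX /=; congr Heis.
- by rewrite !mulmxDr addrACA.
- by rewrite !mulmxDr addrACA.
rewrite /sigma_tilde !bilinE !linearD /= !(dotpDl, dotpDr).
(* Symmetry lets the halved quadratic terms polarise to whole bilinear ones; the mixed identity
   yields [l] times the group cocycle. *)
rewrite (similitude_AD u2 u1) (similitude_CB w2 w1) !similitude_AB.
by field; exact: two_neq0.
Qed.

Lemma hvec_expression s (alpha beta : {scalar 'cV['F_p]_n}) x :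
  has_expression s A B C D l alpha beta ->
  hvec (s x) = block_mx A C D B *m hvec x.
Proof. by case: x => u w z ->; rewrite mul_block_col. Qed.

(** The invertible block matrix recovers [u] and [w]; once these agree, the last coordinates differ
    only through [l * z]. *)
Lemma expression_inj s (alpha beta : {scalar 'cV['F_p]_n}) :
  has_expression s A B C D l alpha beta -> l != 0 -> injective s.
Proof.
move=> sX l0 x y sxy; have U := similitude_unit E l0.
have /(congr1 (@hvec p n)) := sxy; rewrite !(hvec_expression _ sX).
move/(congr1 (mulmx (invmx (block_mx A C D B)))); rewrite !mulKmx //.
case: x y sxy => u w z [u' w' z'] + /eq_col_mx[/= eu ew].
rewrite {}eu {}ew !sX => /(congr1 (@heis_z p n)) /=.
by move=> /addIr/addIr/addIr/addrI/(mulfI l0) ->.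
Qed.

End Similitude.

Lemma End_expression s : s \in End (ES1 p n) ->
  let M := qmatrix (induced s) in
  exists alpha beta : {scalar 'cV['F_p]_n},
    has_expression s (ulsubmx M) (drsubmx M) (ursubmx M) (dlsubmx M)
      (central_mult s) alpha beta.
Proof.
move=> sE M; have /EndP sM := sE.
pose A := ulsubmx M; pose B := drsubmx M; pose C := ursubmx M; pose D := dlsubmx M.
have ME : M = block_mx A C D B by rewrite submxK.
have sim := similitude_End sE; rewrite -/M ME in sim.
have sV u w z : heis_u (s (Heis u w z)) = A *m u + C *m w
             /\ heis_w (s (Heis u w z)) = D *m u + B *m w.
  have := hvec_End sE (Heis u w z).
  by rewrite -/M ME mul_block_col => /eq_col_mx.
pose f u := heis_z (s (Heis u 0 0)) - 2%:R^-1 * dotp (A *m u) (D *m u).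
pose g w := heis_z (s (Heis 0 w 0)) - 2%:R^-1 * dotp (C *m w) (B *m w).
have fD : {morph f : u v / u + v}.
  (* On the vectors (u, 0) the cocycle vanishes, so [u + v] comes from a product in the group; the
     images do have a cocycle term, which the halved correction absorbs. *)
  move=> u v; have -> : f (u + v) = heis_z (s (Heis u 0 0 * Heis v 0 0)%g)
      - 2%:R^-1 * dotp (A *m (u + v)) (D *m (u + v)).
    by rewrite heisM /heis_mul /= dotp0r !addr0.
  rewrite sM heisM /=; have [-> _] := sV u 0 0; have [_ ->] := sV v 0 0.
  rewrite !mulmx0 !addr0 /f !mulmxDr !(dotpDl, dotpDr) (similitude_AD sim v u).
  by field; exact: two_neq0.
have gD : {morph g : u v / u + v}.
  move=> u v; have -> : g (u + v) = heis_z (s (Heis 0 u 0 * Heis 0 v 0)%g)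
      - 2%:R^-1 * dotp (C *m (u + v)) (B *m (u + v)).
    by rewrite heisM /heis_mul /= dotp0l !addr0.
  rewrite sM heisM /=; have [-> _] := sV 0 u 0; have [_ ->] := sV 0 v 0.
  rewrite !mulmx0 !add0r /g !mulmxDr !(dotpDl, dotpDr) (similitude_CB sim v u).
  by field; exact: two_neq0.
have [alpha fE] := Fp_additive_scalar fD; have [beta gE] := Fp_additive_scalar gD.
exists alpha, beta => u w z.
have -> : s (Heis u w z) = Heis (heis_u (s (Heis u w z))) (heis_w (s (Heis u w z)))
                                (heis_z (s (Heis u w z))) by case: (s _).
have [-> ->] := sV u w z; congr Heis.
(* With the [w] factor first, this product has no cocycle term. That of the images is
   [dotp (C *m w) (D *m u)], the last summand of [sigma_tilde]. *)
have -> : Heis u w z = (Heis 0 w 0 * Heis u 0 0 * hcen n z)%g.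
  by rewrite !heisM /heis_mul /= !dotp0l dotp0r !addr0 !add0r.
rewrite !sM End_hcen // !heisM /=.
have [-> _] := sV 0 w 0; have [_ ->] := sV u 0 0.
rewrite dotp0r !mulmx0 !addr0 !add0r /sigma_tilde !bilinE -fE -gE /f /g.
by rewrite -/A -/B -/C -/D; ring.
Qed.

End Expression.

(** * Endomorphic images and automorphism orbits of elements *)

Section Orbits.
Variables p n : nat.
Hypotheses (p_pr : prime p) (p_odd : odd p).
Local Notation G := [set: ES1 p n].
Local Notation Z := 'Z(G)%g.
Implicit Types (g h x y : ES1 p n) (c l : 'F_p).

(** Each pair of factors contributes one [dotp u w] to the central coordinate, hence the binomial
    coefficient. *)
Lemma heis_expg u w c m : (Heis u w c ^+ m)%g =
  Heis (u *+ m) (w *+ m) (c *+ m + dotp u w *+ 'C(m, 2)) :> ES1 p n.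
Proof.
elim: m => [|m IH]; first by rewrite expg0 !mulr0n addr0.
rewrite expgS IH heisM /heis_mul /= -!mulrS binS bin1 mulrnDr; congr Heis.
have -> : dotp u (w *+ m) = dotp u w *+ m.
  by rewrite -scaler_nat dotpZr mulr_natl.
by rewrite mulrS; ring.
Qed.

Lemma heis_expgp h : (h ^+ p)%g = 1%g.
Proof.
have Fp0 c : c *+ p = 0 by exact/mulrn_pchar/pchar_Fp.
have vp0 (u : 'cV['F_p]_n) : u *+ p = 0 by rewrite -scaler_nat Fp0 scale0r.
case: h => u w c; rewrite heis_expg !vp0 Fp0.
(* Oddness of [p] enters here: for [p = 2] this coefficient would be 1. *)
have /dvdnP[k ->] : (p %| 'C(p, 2))%N by rewrite prime_dvd_bin ?odd_prime_gt2.
by rewrite mulrnA Fp0 addr0.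
Qed.

Lemma power_End h (phi : ES1 p n -> 'F_p) :
  {morph phi : x y / (x * y)%g >-> x + y} ->
  [ffun x => h ^+ (phi x : nat)]%g \in End (ES1 p n).
Proof.
move=> phiM; apply/EndP => x y; rewrite !ffunE phiM -expgD.
rewrite -[phi x]natr_Zp -[phi y]natr_Zp -natrD !val_Fp_nat //.
by rewrite !(expg_mod _ (heis_expgp h)) expgD !(expg_mod _ (heis_expgp h)) -expgD.
Qed.

Lemma noncentral_endomorphic g h : g \notin Z -> endomorphic h g.
Proof.
rewrite -hvec_eq0 => /symp_nondeg[v gv0].
(* Normalised so that [phi g = 1], which sends [g] to [h]. *)
pose phi x := (symp (hvec g) v)^-1 * symp (hvec x) v.
have phiM : {morph phi : x y / (x * y)%g >-> x + y}.
  move=> x y; rewrite /phi hvecM !(symp_sym v) sympDr; ring.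
apply/exists_inP; exists [ffun x => h ^+ (phi x : nat)]%g; first exact: power_End.
rewrite ffunE /phi mulVf /= ?modn_small ?expg1 ?eqxx //.
Qed.

(** The diagonal similitude with blocks 1 and [l]; the value [l = 0] is allowed and still gives an
    endomorphism. *)
Definition dilation l x := Heis (heis_u x) (l *: heis_w x) (l * heis_z x) : ES1 p n.

Lemma dilation_End l : [ffun x => dilation l x] \in End (ES1 p n).
Proof.
apply/EndP => x y; rewrite !ffunE /dilation !heisM /heis_mul /=.
by rewrite scalerDr dotpZr !mulrDr.
Qed.

Lemma dilation_inj l : l != 0 -> injective (dilation l).
Proof.
move=> l0 [u w c] [u' w' c'] E; have /= -> := congr1 (@heis_u p n) E.
have /= /(scalerI l0) -> := congr1 (@heis_w p n) E.
by have /= /(mulfI l0) -> := congr1 (@heis_z p n) E.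
Qed.

Lemma dilation_hcen l c : dilation l (hcen n c) = hcen n (l * c).
Proof. by rewrite /dilation /= scaler0. Qed.

Lemma automorphicE y x : automorphic y x = (y \in aut_orbit x).
Proof. by apply/exists_inP/orbitP => -[a aA /eqP E]; exists a => //; apply/eqP. Qed.

Lemma End_automorphic (s : {ffun ES1 p n -> ES1 p n}) x :
  s \in End (ES1 p n) -> injective s -> automorphic (s x) x.
Proof.
move=> sE sI; have [a aA sa] := End_inj_Aut sE sI.
by apply/exists_inP; exists a; rewrite ?sa.
Qed.

(** Conjugation by [k] multiplies [g] by [g, k], and by nondegeneracy this commutator takes every
    central value. *)
Lemma noncentral_translate g c : g \notin Z -> automorphic (g * hcen n c)%g g.
Proof.
rewrite -hvec_eq0 => /symp_nondeg[v gv0].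
pose v' := (c / symp (hvec g) v) *: v.
pose k := Heis (usubmx v') (dsubmx v') 0 : ES1 p n.
have kE : [~ g, k]%g = hcen n c.
  rewrite commg_symp /hvec vsubmxK /v' /symp -scalemxAr mxE.
  by rewrite -[X in _ * X]/(symp (hvec g) v) divfK.
have := @End_automorphic [ffun x => (x ^ k)%g] g.
rewrite ffunE conjg_mulR kE; apply; last by move=> x y; rewrite !ffunE => /conjg_inj.
by apply/EndP => x y; rewrite !ffunE conjMg.
Qed.

Lemma hvec_eq_translate x y : hvec x = hvec y -> exists c, y = (x * hcen n c)%g.
Proof.
case: x y => u w c [u' w' c'] /eq_col_mx[/= -> ->]; exists (c' - c).
by rewrite heisM /heis_mul /= dotp0r !addr0 addrC subrK.
Qed.

(** The lift of [M] with multiplier 1 sends [g] to [h] up to a central factor, which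
    [noncentral_translate] corrects. *)
Lemma symplectic_automorphic M g h :
    M^T *m Delta p n *m M = 1 *: Delta p n -> hvec h = M *m hvec g ->
  h \notin Z -> automorphic h g.
Proof.
move=> sim hE hZ; rewrite -(submxK M) in sim.
(* Any linear form serves as [alpha] and [beta]; the zero function provides one. *)
have [|o _] := @Fp_additive_scalar p _ (fun _ : 'cV['F_p]_n => 0).
  by move=> u v; rewrite addr0.
pose s := [ffun x : ES1 p n =>
  Heis (ulsubmx M *m heis_u x + ursubmx M *m heis_w x)
       (dlsubmx M *m heis_u x + drsubmx M *m heis_w x)
       (sigma_tilde (ulsubmx M) (drsubmx M) (ursubmx M) (dlsubmx M) 1 o o
          (heis_u x) (heis_w x) (heis_z x))].
have sX : has_expression s (ulsubmx M) (drsubmx M) (ursubmx M) (dlsubmx M) 1 o o.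
  by move=> u w c; rewrite ffunE.
have sg : automorphic (s g) g.
  apply: End_automorphic; first exact (expression_End p_pr p_odd sim sX).
  exact: (expression_inj sim sX (oner_neq0 _)).
have hsg : hvec (s g) = hvec h by rewrite (hvec_expression _ sX) submxK.
have [c ->] := hvec_eq_translate hsg.
move: sg; rewrite !automorphicE => sg; apply: orbit_trans sg.
by rewrite -[_ \in _]automorphicE noncentral_translate // -hvec_eq0 hsg hvec_eq0.
Qed.

Lemma noncentral_automorphic g h : g \notin Z -> h \notin Z -> automorphic h g.
Proof.
move=> gZ hZ; have := (gZ, hZ); rewrite -!hvec_eq0 => -[g0 h0].
(* A single transvection cannot join distinct orthogonal vectors, hence the detour through a [v]
   orthogonal to neither. *)
have [v gv vh] := symp_avoid g0 h0.
have [a [t gt]] := transvection_move gv; have [b [r vr]] := transvection_move vh.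
pose k := Heis (usubmx v) (dsubmx v) 0 : ES1 p n.
have kE : hvec k = v by rewrite /hvec vsubmxK.
have kZ : k \notin Z.
  by rewrite -hvec_eq0 kE; apply: contraNneq vh => ->; rewrite /symp trmx0 !mul0mx mxE.
have kg : automorphic k g.
  by apply: symplectic_automorphic (transvection_symp a t) _ kZ; rewrite gt.
have hk : automorphic h k.
  by apply: symplectic_automorphic (transvection_symp b r) _ hZ; rewrite kE vr.
by move: kg hk; rewrite !automorphicE => kg hk; apply: orbit_trans hk kg.
Qed.

(** Numbers the three orbits in increasing order, turning images, orbits and their order into
    comparisons of natural numbers. *)
Definition level x : nat := if x == 1%g then 0%N else if x \in Z then 1%N else 2%N.

Lemma level_hcen c : level (hcen n c) = (c != 0).
Proof.
by rewrite /level hcen_in -[1%g]/(hcen n 0) (inj_eq (@hcen_inj p n)); case: eqP.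
Qed.

Lemma level_le1 x : (level x <= 1)%N = (x \in Z).
Proof. by rewrite /level; case: eqP => [->|_]; rewrite ?group1 //; case: (x \in Z). Qed.

Lemma level_eq0 x : (level x == 0)%N = (x == 1%g).
Proof. by rewrite /level; case: (x == 1%g); case: (x \in Z). Qed.

Lemma level_eq2 x : (level x == 2)%N = (x \notin Z).
Proof. by rewrite -level_le1 /level; case: (x == 1%g); case: (x \in Z). Qed.

Lemma level_le2 x : (level x <= 2)%N.
Proof. by rewrite /level; case: (x == 1%g); case: (x \in Z). Qed.

Lemma endomorphicE y x : endomorphic y x = (level y <= level x)%N.
Proof.
apply/idP/idP => [/exists_inP[s sE /eqP <-]|].
  have [xZ|xZ] := boolP (x \in Z); last first.
    by move: xZ; rewrite -level_eq2 => /eqP->; exact: level_le2.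
  have [c ->] := center_hcenP _ xZ; rewrite End_hcen // !level_hcen.
  by case: (eqVneq c 0) => [->|_]; rewrite ?mulr0 ?eqxx ?leq_b1.
have [xZ yx|xZ _] := boolP (x \in Z); last exact: noncentral_endomorphic.
have yZ : y \in Z by rewrite -level_le1 (leq_trans yx) // level_le1.
have [[c xE] [d yE]] := (center_hcenP _ xZ, center_hcenP _ yZ).
move: yx; rewrite xE yE !level_hcen => cd.
apply/exists_inP; exists [ffun x => dilation (d / c) x]; first exact: dilation_End.
(* If [c = 0], the levels force [d = 0], so the value of [d / c] is immaterial. *)
rewrite ffunE dilation_hcen; case: (eqVneq c 0) cd => [->|c0 _]; last by rewrite divfK.
by rewrite mulr0 leqn0 eqb0 negbK => /eqP->.
Qed.

(** An automorphism and its inverse are both endomorphisms, so the level is preserved. Conversely,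
    [noncentral_automorphic] joins noncentral elements and invertible dilations join nontrivial
    central ones. *)
Lemma aut_orbitE x : aut_orbit x = [set y | level y == level x].
Proof.
apply/setP => y; rewrite inE -automorphicE; apply/idP/idP => [/exists_inP[a aA /eqP E]|].
  rewrite eqn_leq -!endomorphicE -E; apply/andP; split; apply/exists_inP.
    by exists [ffun x => a x]; rewrite ?Aut_End ?ffunE.
  exists [ffun x => (a^-1)%g x]; rewrite ?ffunE ?permK //.
  by apply: Aut_End; rewrite groupV.
have [xZ yx|xZ] := boolP (x \in Z); last first.
  move: (xZ); rewrite -{1}level_eq2 => /eqP->; rewrite level_eq2.
  exact: noncentral_automorphic.
have yZ : y \in Z by rewrite -level_le1 (eqP yx) level_le1.
have [[c xE] [d yE]] := (center_hcenP _ xZ, center_hcenP _ yZ).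
move: yx; rewrite xE yE !level_hcen.
have [-> | c0] := eqVneq c 0; have [-> // | d0 // _] := eqVneq d 0.
  by rewrite automorphicE orbit_refl.
have dc0 : d / c != 0 by rewrite mulf_neq0 ?invr_neq0.
have := @End_automorphic [ffun x => dilation (d / c) x] (hcen n c).
rewrite ffunE dilation_hcen divfK //; apply; first exact: dilation_End.
by move=> u v; rewrite !ffunE => /(dilation_inj dc0).
Qed.

End Orbits.

(** * Orders of the group and of its centre *)

Section Counting.
Variables p n : nat.
Hypothesis p_pr : prime p.
Local Notation G := [set: ES1 p n].
Local Notation Z := 'Z(G)%g.

Lemma card_heis : #|G| = (p ^ (2 * n + 1))%N.
Proof.
have pairK : cancel (@pair_heis p n) (@heis_pair p n) by case=> [[u w] c].
rewrite cardsT (bij_eq_card (Bijective (@heis_pairK p n) pairK)).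
rewrite !card_prod !card_mx card_Fp // muln1 -!expnD -expnSr.
by rewrite addnn -mul2n addn1.
Qed.

Lemma card_heis_center : #|Z| = p.
Proof.
have -> : Z = [set hcen n c | c : 'F_p].
  apply/setP => x; apply/center_hcenP/imsetP => [[c ->]|[c _ ->]]; by exists c.
by rewrite card_imset ?cardsT ?card_Fp //; exact: hcen_inj.
Qed.

End Counting.

(** * Image sets, orbits and their order in terms of levels *)

Section OrbitOrder.
Variables p n : nat.
Hypotheses (p_pr : prime p) (p_odd : odd p).
Local Notation G := [set: ES1 p n].
Local Notation Z := 'Z(G)%g.
Implicit Types (x y g : ES1 p n).

Lemma level_set0 : [set x : ES1 p n | level x == 0]%N = [set 1%g].
Proof. by apply/setP => x; rewrite !inE level_eq0. Qed.

Lemma level_set1 : [set x : ES1 p n | level x == 1]%N = Z :\ 1%g.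
Proof.
by apply/setP => x; rewrite inE in_setD1 -level_le1 -level_eq0; case: (level x) => [|[]].
Qed.

Lemma level_set2 : [set x : ES1 p n | level x == 2]%N = G :\: Z.
Proof. by apply/setP => x; rewrite inE level_eq2 in_setD in_setT andbT. Qed.

Lemma level_le_set0 : [set x : ES1 p n | level x <= 0]%N = [set 1%g].
Proof. by apply/setP => x; rewrite !inE leqn0 level_eq0. Qed.

Lemma level_le_set1 : [set x : ES1 p n | level x <= 1]%N = Z.
Proof. by apply/setP => x; rewrite inE level_le1. Qed.

Lemma level_le_set2 : [set x : ES1 p n | level x <= 2]%N = G.
Proof. by apply/setP => x; rewrite !inE level_le2. Qed.

Lemma End_imagesE g : End_images g = [set y | level y <= level g]%N.
Proof.
apply/setP => y; rewrite inE -endomorphicE //.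
by apply/imsetP/exists_inP => -[s sE]; [move=> ->|move=> /eqP <-]; exists s; rewrite ?eqxx.
Qed.

Lemma orbit_leE x y :
  orbit_le (aut_orbit y) (aut_orbit x) = (level y <= level x)%N.
Proof.
apply/exists_inP/idP => [[y' + /exists_inP[x']]|le_yx].
  by rewrite !aut_orbitE // !inE endomorphicE // => /eqP <- /eqP <-.
exists y; first by rewrite aut_orbitE ?inE.
by apply/exists_inP; exists x; rewrite ?aut_orbitE ?inE ?endomorphicE.
Qed.

Hypothesis n_gt0 : (0 < n)%N.

Lemma level_surj m : (m <= 2)%N -> exists x, level x = m.
Proof.
case: m => [|[|[|//]]] _; first by exists (hcen n 0); rewrite level_hcen eqxx.
  by exists (hcen n 1); rewrite level_hcen oner_eq0.
(* Positivity of [n] supplies a noncentral element. *)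
exists (heis_x (Ordinal n_gt0)); apply/eqP; rewrite level_eq2.
apply/heis_centerP => -[/colP/(_ (Ordinal n_gt0))/eqP + _].
by rewrite !mxE !eqxx oner_eq0.
Qed.

Lemma aut_orbits_level :
  aut_orbits (ES1 p n) = [set [set 1%g]; Z :\ 1%g; G :\: Z].
Proof.
rewrite -level_set1 -level_set0 -level_set2; apply/setP => O; rewrite !inE.
apply/imsetP/idP => [[x _ ->]|].
  rewrite aut_orbitE //; have := level_le2 x.
  by case: (level x) => [|[|[]]] //; rewrite eqxx ?orbT.
have H m : (m <= 2)%N -> O = [set y | level y == m] ->
    exists2 x, x \in G & O = aut_orbit x.
  move=> /level_surj[x <-] ->; exists x; rewrite ?in_setT //.
  by rewrite aut_orbitE.
by case/orP => [/orP[]|] /eqP; exact: H.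
Qed.

End OrbitOrder.

Theorem mainTheorem1 (p n : nat) (hp : prime p) (hodd : odd p) (hn : (0 < n)%N) :
  let Z : {group ES1 p n} := 'Z([set: ES1 p n])%G in
  let bar (x : ES1 p n) : coset_of 'Z([set: ES1 p n]) := coset _ x in
  (* (A) *)
  (forall s : {ffun ES1 p n -> ES1 p n}, s \in End (ES1 p n) ->
     exists l : 'F_p,
       (forall z, generator Z z -> s z = (z ^+ (l : nat))%g) /\
       (forall z, generator Z z -> forall x y : ES1 p n,
          sympform p z (induced s (bar x)) (induced s (bar y))
          = l * sympform p z (bar x) (bar y)))
  /\
  (* (B) *)
  ((forall s : {ffun ES1 p n -> ES1 p n}, s \in End (ES1 p n) ->
     exists (A B C D : 'M['F_p]_n) (l : 'F_p) (alpha beta : {scalar 'cV['F_p]_n}),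
       [/\ qmatrix (induced s) = block_mx A C D B,
           qmatrix (induced s) \in symp_scalar p n,
           (qmatrix (induced s))^T *m Delta p n *m qmatrix (induced s)
             = l *: Delta p n
         & has_expression s A B C D l alpha beta])
   /\
   (forall (s : {ffun ES1 p n -> ES1 p n})
      (A B C D : 'M['F_p]_n) (l : 'F_p) (alpha beta : {scalar 'cV['F_p]_n}),
      (block_mx A C D B)^T *m Delta p n *m block_mx A C D B = l *: Delta p n ->
      has_expression s A B C D l alpha beta ->
      s \in End (ES1 p n)))
  /\
  (* (C) *)
  (forall a : {perm ES1 p n}, a \in Aut [set: ES1 p n] ->
     exists l : 'F_p,
       [/\ l != 0,
           forall z, generator Z z -> a z = (z ^+ (l : nat))%g
         & forall z, generator Z z -> forall x y : ES1 p n,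
             sympform p z (induced a (bar x)) (induced a (bar y))
             = l * sympform p z (bar x) (bar y)])
  /\
  (* (D) *)
  ((forall a : {perm ES1 p n}, a \in Aut [set: ES1 p n] ->
     exists (A B C D : 'M['F_p]_n) (l : 'F_p) (alpha beta : {scalar 'cV['F_p]_n}),
       [/\ qmatrix (induced a) = block_mx A C D B,
           qmatrix (induced a) \in Sp_scalar p n,
           (qmatrix (induced a))^T *m Delta p n *m qmatrix (induced a)
             = l *: Delta p n,
           l != 0
         & has_expression a A B C D l alpha beta])
   /\
   (forall (s : {ffun ES1 p n -> ES1 p n})
      (A B C D : 'M['F_p]_n) (l : 'F_p) (alpha beta : {scalar 'cV['F_p]_n}),
      (block_mx A C D B)^T *m Delta p n *m block_mx A C D B = l *: Delta p n ->
      l != 0 ->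
      has_expression s A B C D l alpha beta ->
      exists2 a : {perm ES1 p n}, a \in Aut [set: ES1 p n] & s =1 a))
  /\
  (* (E) *)
  (forall g : ES1 p n,
     [/\ g = 1%g -> End_images g = [set 1%g] /\ #|End_images g| = 1%N,
         g \in Z :\ 1%g -> End_images g = Z /\ #|End_images g| = p
       & g \in [set: ES1 p n] :\: Z ->
           End_images g = [set: ES1 p n]
           /\ #|End_images g| = (p ^ (2 * n + 1))%N])
  /\
  (* (F) *)
  [/\ aut_orbits (ES1 p n)
        = [set [set 1%g]; Z :\ 1%g; [set: ES1 p n] :\: Z],
      #|aut_orbits (ES1 p n)| = 3%N,
      #|[set 1%g : ES1 p n]| = 1%N,
      #|Z :\ 1%g| = (p - 1)%N
    & #|[set: ES1 p n] :\: Z| = (p ^ (2 * n + 1) - p)%N]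
  /\
  (* (G) *)
  [/\ End_induces_order (ES1 p n),
      [/\ {in aut_orbits (ES1 p n), reflexive (@orbit_le (ES1 p n))},
          {in aut_orbits (ES1 p n) &, antisymmetric (@orbit_le (ES1 p n))},
          {in aut_orbits (ES1 p n) & &, transitive (@orbit_le (ES1 p n))}
        & {in aut_orbits (ES1 p n) &, total (@orbit_le (ES1 p n))}],
      orbit_lt [set 1%g : ES1 p n] (Z :\ 1%g)
    & orbit_lt (Z :\ 1%g) ([set: ES1 p n] :\: Z)].
Proof.
move=> Z bar.
have partA (s : {ffun ES1 p n -> ES1 p n}) : s \in End (ES1 p n) ->
    (forall z, generator Z z -> s z = (z ^+ (central_mult s : nat))%g) /\
    (forall z, generator Z z -> forall x y : ES1 p n,
       sympform p z (induced s (bar x)) (induced s (bar y))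
       = central_mult s * sympform p z (bar x) (bar y)).
  by move=> sE; split=> z gz; [exact: End_generator | move=> x y; exact: sympform_End].
have partB (s : {ffun ES1 p n -> ES1 p n}) : s \in End (ES1 p n) ->
    exists (A B C D : 'M['F_p]_n) (alpha beta : {scalar 'cV['F_p]_n}),
      qmatrix (induced s) = block_mx A C D B
      /\ has_expression s A B C D (central_mult s) alpha beta.
  move=> sE; have [alpha [beta sX]] := End_expression hp hodd sE.
  by do 4![eexists]; exists alpha, beta; split; last exact: sX; rewrite submxK.
(* Automorphisms are permutations, while the results on endomorphisms concern finite functions; [fa]
   passes between them without changing the induced map. *)
pose fa (a : {perm ES1 p n}) := [ffun x => a x].
have induced_fa a : induced (fa a) =1 induced a.
  by move=> X; rewrite /induced ffunE.
have qmatrix_fa a : qmatrix (induced (fa a)) = qmatrix (induced a).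
  by apply/matrixP => i j; rewrite !mxE induced_fa.
have mult_neq0 a : a \in Aut [set: ES1 p n] -> central_mult (fa a) != 0.
  (* With multiplier 0, [a] would send both [hcen 1] and [hcen 0] to the identity, against
     injectivity. *)
  move=> aA; apply: contra_eq_neq (End_hcen (Aut_End aA) 1) => ->.
  rewrite mul0r ffunE -(_ : a (hcen n 0) = hcen n 0); last first.
    by have := End_hcen (Aut_End aA) 0; rewrite mulr0 ffunE.
  by rewrite (inj_eq perm_inj) (inj_eq (@hcen_inj p n)) oner_eq0.
have orbit_ex O : O \in aut_orbits (ES1 p n) -> exists x, O = aut_orbit x.
  by case/imsetP => x _ ->; exists x.
have lt_level m : (m < 2)%N -> orbit_lt [set x : ES1 p n | level x == m]
                                        [set x : ES1 p n | level x == m.+1].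
  move=> m2; have [x xm] := level_surj p hn (ltnW m2).
  (* The hypothesis [m < 2] unfolds to [m.+1 <= 2], so it also gives an element of the next
     level. *)
  have [y ym] := level_surj p hn m2.
  apply/andP; split; last first.
    by rewrite -{1}xm -ym -!aut_orbitE // orbit_leE // xm ym.
  by apply/eqP => /setP/(_ x); rewrite !inE xm eqxx ltn_eqF.
have lt01 : orbit_lt [set 1%g : ES1 p n] (Z :\ 1%g).
  by rewrite -level_set1 -level_set0; exact: lt_level.
have lt12 : orbit_lt (Z :\ 1%g) ([set: ES1 p n] :\: Z).
  by rewrite -level_set1 -level_set2; exact: lt_level.
have cardZ : #|Z| = p by exact: card_heis_center.
split; [|split; [|split; [|split; [|split; [|split]]]]].
- by move=> s /partA sA; exists (central_mult s).
- split=> [s sE|s A B C D l alpha beta sim]; last exact: (expression_End hp hodd sim).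
  have [A [B [C [D [alpha [beta [ME sX]]]]]]] := partB s sE.
  exists A, B, C, D, (central_mult s), alpha, beta; split=> //.
    by rewrite inE; apply/existsP; exists (central_mult s); rewrite similitude_End.
  exact: similitude_End.
- move=> a aA; have [aZ af] := partA _ (Aut_End aA).
  exists (central_mult (fa a)); split; first exact: mult_neq0.
    by move=> z /aZ <-; rewrite ffunE.
  by move=> z gz x y; rewrite -(af z gz x y)
      (induced_fa a (bar x)) (induced_fa a (bar y)).
- split=> [a aA|s A B C D l alpha beta sim l0 sX]; last first.
    apply: End_inj_Aut; first exact: (expression_End hp hodd sim sX).
    exact: (expression_inj sim sX l0).
  have [A [B [C [D [alpha [beta [ME sX]]]]]]] := partB _ (Aut_End aA).
  have sim := similitude_End (Aut_End aA); have l0 := mult_neq0 a aA.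
  exists A, B, C, D, (central_mult (fa a)), alpha, beta.
  rewrite -/(fa a) qmatrix_fa in sim ME; split=> //.
    rewrite inE (similitude_unit sim l0); apply/existsP.
    by exists (central_mult (fa a)); rewrite l0 sim eqxx.
  by move=> u w z; rewrite -sX ffunE.
- move=> g; rewrite End_imagesE //; split.
  + by move/eqP; rewrite -level_eq0 => /eqP ->; rewrite level_le_set0 cards1.
  + by rewrite -level_set1 inE => /eqP ->; rewrite level_le_set1.
  + by rewrite -level_set2 inE => /eqP ->; rewrite level_le_set2 card_heis.
- have neq01 : [set 1%g : ES1 p n] != Z :\ 1%g by have /andP[] := lt01.
  have neq12 : Z :\ 1%g != [set: ES1 p n] :\: Z by have /andP[] := lt12.
  split; rewrite ?aut_orbits_level ?cards1 //.
  (* The remaining inequality holds because the identity lies in the first set but not outside the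
     centre. *)
  + rewrite setUC cardsU1 cards2 neq01 !inE negb_or [_ == Z :\ 1%g]eq_sym neq12.
    by rewrite andbT; case: eqP => // /setP/(_ 1%g); rewrite !inE eqxx group1.
  + have := cardsD1 1%g Z; rewrite group1 cardZ => /(congr1 (subn^~ 1)%N).
    by rewrite addKn => /esym.
  + by rewrite cardsD setTI card_heis // cardZ.
(* All the order properties are inherited from [<=] on levels. *)
- split=> //.
  + by move=> x y; rewrite !endomorphicE // automorphicE aut_orbitE // inE eqn_leq => -> ->.
  + split.
    * by move=> O /orbit_ex[x ->]; rewrite orbit_leE.
    * move=> O1 O2 /orbit_ex[x ->] /orbit_ex[y ->]; rewrite !orbit_leE // -eqn_leq.
      by rewrite !aut_orbitE // => /eqP->.
    * move=> O1 O2 O3 /orbit_ex[x ->] /orbit_ex[y ->] /orbit_ex[z ->].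
      by rewrite !orbit_leE //; exact: leq_trans.
    * by move=> O1 O2 /orbit_ex[x ->] /orbit_ex[y ->]; rewrite !orbit_leE // leq_total.
Qed.
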